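(* If $A_1$ and $A_2$ are (complex) unitary matrices, then $$\mu(A_1\otimes A_2)\le\mu(A_1)\cdot\mu(A_2).$$ In particular, for a unitary matrix $A$ and an integer $p\ge1$, $$\mu(A^{\otimes p})\le\mu(A)^p.$$
   Context: For an $n\times n$ unitary matrix $A$, the uncertainty constant of $A$ is $\mu(A):=\min_{f\in\mathbb C^n\setminus\{0\}}|\mathrm{supp}(f)|\cdot|\mathrm{supp}(Af)|$, where $\mathrm{supp}(f)=\{k:f(k)\ne0\}$ and $|\cdot|$ of a set is its cardinality. Tensor product convention (indices from $0$): for $A$ of size $N\times N$ and $B$ of size $M\times M$, $(A\otimes B)_{i_1+Ni_2,\,j_1+Nj_2}=A_{i_1j_1}B_{i_2j_2}$ for $0\le i_1,j_1\le N-1$, $0\le i_2,j_2\le M-1$. $A^{\otimes1}=A$, $A^{\otimes n}=A\otimes A^{\otimes(n-1)}$. *)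

(* Defs.v *)
From mathcomp Require Import all_boot all_order all_algebra.
From mathcomp Require Import boolp reals.
From mathcomp.real_closed Require Import complex mxtens.

Set Implicit Arguments.
Unset Strict Implicit.
Unset Printing Implicit Defensive.

Import Order.TTheory GRing.Theory Num.Theory.
Local Open Scope ring_scope.

Definition supp (R : realType) (n : nat) (f : 'cV[R[i]]_n) : {set 'I_n} :=
  [set k | f k 0 != 0].

Definition uncertainty_value (R : realType) (n : nat) (A : 'M[R[i]]_n)
    (k : nat) : Prop :=
  exists2 f : 'cV[R[i]]_n, f != 0 & k = (#|supp f| * #|supp (A *m f)|)%N.

(* The minimum is taken over a set of naturals that is nonempty as soon as
   0 < n; for the 0 x 0 matrix there is no nonzero f and the value is 0. *)
Definition mu (R : realType) (n : nat) (A : 'M[R[i]]_n) : nat :=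
  if pselect (exists k, `[< uncertainty_value A k >]) is left ex
  then ex_minn ex else 0%N.

Lemma uncertainty_value_mu (R : realType) (n : nat) (A : 'M[R[i]]_n) :
  (0 < n)%N -> uncertainty_value A (mu A).
Proof.
move=> n_gt0; rewrite /mu; case: pselect => [ex|[]].
  by case: ex_minnP => k /asboolP.
pose f : 'cV[R[i]]_n := const_mx 1.
exists (#|supp f| * #|supp (A *m f)|)%N; apply/asboolP; exists f => //.
apply/eqP => /matrixP/(_ (Ordinal n_gt0) 0); rewrite !mxE.
by apply/eqP; rewrite oner_eq0.
Qed.

Lemma mu_le (R : realType) (n : nat) (A : 'M[R[i]]_n) (f : 'cV[R[i]]_n) :
  f != 0 -> (mu A <= #|supp f| * #|supp (A *m f)|)%N.
Proof.
move=> f_neq0; rewrite /mu; case: pselect => // ex.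
by case: ex_minnP => k _; apply; apply/asboolP; exists f.
Qed.

(* The first factor carries the least significant digit of the index
   i1 + N * i2 (see tensorE), whereas in mxtens the first factor carries the
   most significant one: hence the swap. *)
Definition tensor (R : realType) (N M : nat) (A : 'M[R[i]]_N)
    (B : 'M[R[i]]_M) : 'M[R[i]]_(N * M) :=
  castmx (mulnC M N, mulnC M N) (B *t A).

Lemma tensorE (R : realType) (N M : nat) (A : 'M[R[i]]_N) (B : 'M[R[i]]_M)
    (i1 j1 : 'I_N) (i2 j2 : 'I_M) (i j : 'I_(N * M)) :
  i = (i1 + N * i2)%N :> nat -> j = (j1 + N * j2)%N :> nat ->
  tensor A B i j = A i1 j1 * B i2 j2.
Proof.
move=> ei ej; rewrite castmxE mulrC -tensmxE.
by congr ((B *t A) _ _); apply: val_inj; rewrite /= ?ei ?ej addnC mulnC.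
Qed.

(* n ^ 1 is convertible to n, and n ^ p.+2 to n * n ^ p.+1. The p = 0 case is
   only there to make the function total. *)
Fixpoint tensor_pow (R : realType) (n : nat) (A : 'M[R[i]]_n) (p : nat) :
    'M[R[i]]_(n ^ p) :=
  match p return 'M[R[i]]_(n ^ p) with
  | 0 => 1%:M
  | q.+1 =>
      match q return 'M[R[i]]_(n ^ q) -> 'M[R[i]]_(n ^ q.+1) with
      | 0 => fun=> A
      | _.+1 => fun B => tensor A B
      end (tensor_pow A q)
  end.

(* Main.v *)
(* Take minimizers f and g for the two factors: (A (x) B)(f (x) g) equals
   (A f) (x) (B g), and the support of f (x) g is in bijection with the product
   of the supports, so f (x) g realizes the value mu A * mu B. *)

Require Import Defs.
From mathcomp Require Import all_boot all_order all_algebra.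
From mathcomp Require Import boolp reals.
From mathcomp.real_closed Require Import complex mxtens.

Set Implicit Arguments.
Unset Strict Implicit.
Unset Printing Implicit Defensive.

Import Order.TTheory GRing.Theory Num.Theory.
Local Open Scope ring_scope.

(** Target sizes are variables so that the equalities can be eliminated, which is impossible for
    [mulnC M N] itself. *)
Lemma mul_castmx (S : pzSemiRingType) (m n p m' n' p' : nat)
    (em : m = m') (en : n = n') (ep : p = p')
    (X : 'M[S]_(m, n)) (Y : 'M[S]_(n, p)) :
  castmx (em, en) X *m castmx (en, ep) Y = castmx (em, ep) (X *m Y).
Proof. by case: m' / em; case: n' / en; case: p' / ep; rewrite !castmx_id. Qed.

(** Same swap as in [tensor], so that the inner casts agree in a product; [muln1 1] brings the
    [1 * 1] columns back to one. *)
Definition tensorv (R : realType) (N M : nat) (f : 'cV[R[i]]_N)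
    (g : 'cV[R[i]]_M) : 'cV[R[i]]_(N * M) :=
  castmx (mulnC M N, muln1 1) (g *t f).

Lemma tensor_mul_tensorv (R : realType) (N M : nat) (A : 'M[R[i]]_N)
    (B : 'M[R[i]]_M) (f : 'cV[R[i]]_N) (g : 'cV[R[i]]_M) :
  tensor A B *m tensorv f g = tensorv (A *m f) (B *m g).
Proof. by rewrite /tensor /tensorv mul_castmx tensmx_mul. Qed.

Lemma tensorvE (R : realType) (N M : nat) (f : 'cV[R[i]]_N)
    (g : 'cV[R[i]]_M) (i : 'I_N) (j : 'I_M) :
  tensorv f g (cast_ord (mulnC M N) (mxtens_index (j, i))) 0 = f i 0 * g j 0.
Proof.
rewrite /tensorv castmxE cast_ordK mulrC -[in RHS]tensmxE.
by congr ((g *t f) _ _); apply: val_inj.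
Qed.

Lemma card_supp_tensorv (R : realType) (N M : nat) (f : 'cV[R[i]]_N)
    (g : 'cV[R[i]]_M) :
  #|supp (tensorv f g)| = (#|supp f| * #|supp g|)%N.
Proof.
pose h (x : 'I_M * 'I_N) := cast_ord (mulnC M N) (mxtens_index x).
have h_inj : injective h.
  exact: inj_comp (@cast_ord_inj _ _ _) (can_inj (@mxtens_indexK _ _)).
suff -> : supp (tensorv f g) = h @: setX (supp g) (supp f).
  by rewrite card_imset // cardsX mulnC.
apply/setP => k.
(* Every index is some [h (j, i)]; there the entry is [f i 0 * g j 0], which is nonzero exactly when
   both factors are. *)
have -> : k = h (mxtens_unindex (cast_ord (esym (mulnC M N)) k)).
  by rewrite /h mxtens_unindexK cast_ordKV.
case: (mxtens_unindex _) => j i.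
by rewrite mem_imset // !inE tensorvE mulf_eq0 negb_or andbC.
Qed.

Lemma card_supp_gt0 (R : realType) (n : nat) (f : 'cV[R[i]]_n) :
  (0 < #|supp f|)%N = (f != 0).
Proof.
rewrite card_gt0; congr (~~ _); apply/eqP/eqP => [/setP f0|->].
  by apply/colP => k; have := f0 k; rewrite !inE mxE => /negbFE/eqP.
by apply/setP => k; rewrite !inE mxE eqxx.
Qed.

(** The size enters through an equation because it will be a product [N * M] with a zero factor. *)
Lemma mu_dim0 (R : realType) (n : nat) (A : 'M[R[i]]_n) : n = 0%N -> mu A = 0%N.
Proof.
move=> n0; rewrite /mu; case: pselect => // -[k /asboolP[f /eqP[]]].
by apply/colP => -[m m_lt]; exfalso; rewrite n0 in m_lt.
Qed.

Lemma mu_tensor_le (R : realType) (N M : nat) (A : 'M[R[i]]_N)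
    (B : 'M[R[i]]_M) :
  (mu (tensor A B) <= mu A * mu B)%N.
Proof.
(* Minimizers exist only in positive dimension; otherwise the left side is the default 0. *)
have [N0|N_gt0] := posnP N; first by rewrite mu_dim0 // N0.
have [M0|M_gt0] := posnP M; first by rewrite mu_dim0 // M0 muln0.
have [f f_neq0 ->] := uncertainty_value_mu A N_gt0.
have [g g_neq0 ->] := uncertainty_value_mu B M_gt0.
rewrite mulnACA -2!card_supp_tensorv -tensor_mul_tensorv; apply: mu_le.
by rewrite -card_supp_gt0 card_supp_tensorv muln_gt0 !card_supp_gt0 f_neq0.
Qed.

Lemma mu_tensor_pow_le (R : realType) (n : nat) (A : 'M[R[i]]_n) (p : nat) :
  (mu (tensor_pow A p.+1) <= mu A ^ p.+1)%N.
Proof.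
(* [[leqRHS]] keeps the rewriting away from the power of [n] in the matrix type; the matrices
   themselves agree by conversion. *)
elim: p => [|p IHp]; first by rewrite [leqRHS]expn1.
by rewrite [leqRHS]expnS (leq_trans (mu_tensor_le _ _)) // leq_mul2l IHp orbT.
Qed.

Theorem proposition5p10 (R : realType) :
  (forall (N M : nat) (A1 : 'M[R[i]]_N) (A2 : 'M[R[i]]_M),
     A1 \is unitarymx -> A2 \is unitarymx ->
     (mu (tensor A1 A2) <= mu A1 * mu A2)%N) /\
  (forall (n : nat) (A : 'M[R[i]]_n) (p : nat),
     A \is unitarymx -> (1 <= p)%N ->
     (mu (tensor_pow A p) <= mu A ^ p)%N).
Proof.
split=> [N M A1 A2 _ _|n A [//|p] _ _]; first exact: mu_tensor_le.
exact: mu_tensor_pow_le.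
Qed.
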